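(* Let $a>0$, $\theta>0$, $H>0$ and $\tilde\beta\ge 0$ be real constants. Then the one-dimensional dynamics $$\frac{d\tilde x}{dt}=-a\tilde x+\tilde\beta\,\frac{H\tilde x^2}{\theta\tilde x^2+1}$$ are asymptotically stable, i.e. they have an asymptotically stable equilibrium point.
   Context: The scalar ODE is the condensed one-dimensional mapping of the dynamics of a graph under adversarial perturbation: $\tilde x$ is the condensed node state, $a$ a positive constant, $H$ the average in-degree weight, $\tilde\beta$ an out-degree-weighted average of the weighted in-degrees, and $\theta>0$ a parameter. Asymptotic stability (as defined in the paper): for $\frac{dx}{dt}=v(x)$ with $v$ locally Lipschitz on a domain containing the origin and $v(0)=0$, the equilibrium point $x=0$ is asymptotically stable if there exists $\tau>0$ such that $\|x(t_0)\|<\tau$ implies $\lim_{t\to\infty}x(t)=0$; other equilibria are translated to the origin. *)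

(* Defs.v *)
From Stdlib Require Import Reals.
From Coquelicot Require Import Coquelicot.
Open Scope R_scope.

Definition locally_lipschitz {V : NormedModule R_AbsRing} (v : V -> V) : Prop :=
  forall x : V, exists (L : R) (d : posreal),
    forall y z : V, ball_norm x d y -> ball_norm x d z ->
      norm (minus (v y) (v z)) <= L * norm (minus y z).

(* Classical solution of dx/dt = v(x) on [t0, +oo); only the values of the
   total function x on that half-line matter.  is_derive is two-sided, hence
   the initial time is covered by right-continuity. *)
Definition forward_solution {V : NormedModule R_AbsRing}
    (v : V -> V) (t0 : R) (x : R -> V) : Prop :=
  (forall t : R, t0 < t -> is_derive x t (v (x t))) /\
  filterlim x (at_right t0) (locally (x t0)).

(* The existence clause excludes vacuous convergence: without it, a field such
   as v(x) = x^3, whose nonzero solutions blow up in finite time, would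
   qualify. *)
Definition asymptotically_stable_origin {V : NormedModule R_AbsRing}
    (v : V -> V) : Prop :=
  locally_lipschitz v /\ v zero = zero /\
  exists tau : R, 0 < tau /\
    forall (t0 : R) (x0 : V), norm x0 < tau ->
      (exists x : R -> V, forward_solution v t0 x /\ x t0 = x0) /\
      (forall x : R -> V, forward_solution v t0 x -> x t0 = x0 ->
         filterlim x (Rbar_locally p_infty) (locally (zero : V))).

Definition asymptotically_stable_at {V : NormedModule R_AbsRing}
    (v : V -> V) (xe : V) : Prop :=
  asymptotically_stable_origin (fun y : V => v (plus xe y)).

Definition condensed_field (a H theta beta : R) (x : R) : R :=
  - a * x + beta * (H * x ^ 2 / (theta * x ^ 2 + 1)).

(* Main.v *)
(** The equilibrium is [0].  The field is globally Lipschitz, so a solution is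
    determined by its initial value, and it suffices to exhibit one solution
    from each small [x0] and to check that it decays.  Writing
    [x t = x0 * exp (- z (t - t0))] turns the equation into [z' = g z] with
    [z 0 = 0], where [g] lies between [a / 2] and [2 * a]; this is solved by
    inverting a primitive of [1 / g], and [z t >= a / 2 * t]. *)

Require Import Defs.
From Stdlib Require Import Reals Lra FunctionalExtensionality.
From Coquelicot Require Import Coquelicot.
Open Scope R_scope.

(** * Existence for scalar autonomous equations *)

Lemma exp_le (x y : R) : x <= y -> exp x <= exp y.
Proof.
  intros [Hlt| ->]; [left; apply exp_increasing, Hlt|right; reflexivity].
Qed.

(** Mean value theorem without assuming [x <= y]. The bound on [c - x] lets [c] be forced close to
    [x], which is what differentiating an inverse function requires. *)
Lemma is_derive_increment (f df : R -> R) (x y : R) :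
  (forall t, is_derive f t (df t)) ->
  exists c, Rabs (c - x) <= Rabs (y - x) /\ f y - f x = df c * (y - x).
Proof.
  intros Hf.
  destruct (MVT_gen f x y df) as [c [Hc Heq]].
  - intros t _; apply Hf.
  - intros t _; apply continuity_pt_filterlim.
    apply (ex_derive_continuous f); exists (df t); apply Hf.
  - exists c; split; [|exact Heq].
    revert Hc; unfold Rmin, Rmax; destruct (Rle_dec x y); intros Hc;
      unfold Rabs; repeat destruct Rcase_abs; lra.
Qed.

(** Separation of variables: with [G] the primitive of [1 / g] vanishing at 0, a solution satisfies
    [G (z t) = t]. Positivity of [g] makes [G] increasing, and [g <= M] keeps its slope at least
    [1 / M], so [G] maps onto the whole line. *)
Lemma autonomous_ode_solution (g : R -> R) (m M : R) :
  0 < m -> (forall y, continuous g y) -> (forall y, m <= g y <= M) ->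
  exists z : R -> R, z 0 = 0 /\ forall t, is_derive z t (g (z t)).
Proof.
  intros Hm Hg Hb.
  assert (HM : 0 < M) by (destruct (Hb 0); lra).
  assert (Hgp : forall y, 0 < g y) by (intros y; destruct (Hb y); lra).
  assert (Hf : forall y, continuous (fun s => / g s) y).
  { intros y; apply continuous_Rinv_comp; [apply Hg|].
    specialize (Hgp y); lra. }
  set (G := RInt (fun s => / g s) 0).
  assert (HG : forall y, is_derive G y (/ g y)).
  { intros y; apply (is_derive_RInt (V := R_NormedModule) (fun s => / g s) G 0); [|apply Hf].
    exists (mkposreal 1 Rlt_0_1); intros t _.
    apply (RInt_correct (V := R_CompleteNormedModule)).
    apply (ex_RInt_continuous (V := R_CompleteNormedModule)); intros s _; apply Hf. }
  assert (HG0 : G 0 = 0) by apply (RInt_point (V := R_CompleteNormedModule)).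
  assert (Hcont : forall y, continuity_pt G y).
  { intros y; apply continuity_pt_filterlim.
    apply (ex_derive_continuous G); exists (/ g y); apply HG. }
  (* Solved for [y2 - y1], so that along [G (z t) = t] an increment of [z] is [g c] times the
     increment of time. *)
  assert (Hinc : forall y1 y2, exists c, Rabs (c - y1) <= Rabs (y2 - y1) /\
            y2 - y1 = g c * (G y2 - G y1)).
  { intros y1 y2.
    destruct (is_derive_increment G (fun y => / g y) y1 y2 HG) as [c [Hc He]].
    exists c; split; [exact Hc|]; rewrite He; specialize (Hgp c); field; lra. }
  assert (Hsurj : forall t, {y | G y = t}).
  { intros t.
    (* Since [G] has slope at least [1 / M], it is at least [|t|] at [r] and at most [-|t|] at
       [- r]; this brackets [t] for the intermediate value theorem. *)
    set (r := M * Rabs t).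
    assert (Hr : 0 <= r) by (apply Rmult_le_pos; [lra|apply Rabs_pos]).
    pose proof (Rle_abs t) as Ht1; pose proof (Rle_abs (- t)) as Ht2.
    rewrite Rabs_Ropp in Ht2.
    assert (H1 : t <= G r).
    { destruct (Hinc 0 r) as [c [_ Hc]]; rewrite HG0, !Rminus_0_r in Hc.
      destruct (Hb c); unfold r in Hc at 1.
      apply Rle_trans with (Rabs t); [lra|].
      destruct (Rle_lt_dec (Rabs t) (G r)) as [|Hlt]; [lra|].
      pose proof (Rabs_pos t); nra. }
    assert (H2 : G (- r) <= t).
    { destruct (Hinc 0 (- r)) as [c [_ Hc]]; rewrite HG0, !Rminus_0_r in Hc.
      destruct (Hb c); unfold r in Hc at 1.
      apply Rle_trans with (- Rabs t); [|lra].
      destruct (Rle_lt_dec (G (- r)) (- Rabs t)) as [|Hlt]; [lra|].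
      pose proof (Rabs_pos t); nra. }
    destruct (IVT_cor (fun y => G y - t) (- r) r) as [y [_ Hy]].
    - intros y; apply continuity_pt_minus; [apply Hcont|].
      apply continuity_pt_const; intros u v; reflexivity.
    - lra.
    - nra.
    - exists y; lra. }
  exists (fun t => proj1_sig (Hsurj t)).
  set (z := fun t => proj1_sig (Hsurj t)).
  assert (HGz : forall t, G (z t) = t) by (intros t; apply (proj2_sig (Hsurj t))).
  split.
  - fold (z 0); destruct (Hinc 0 (z 0)) as [c [_ Hc]].
    rewrite HGz, HG0 in Hc; lra.
  - intros t; change (is_derive z t (g (z t))).
    apply is_derive_Reals; intros eps Heps.
    pose proof (proj2 (continuity_pt_filterlim g (z t)) (Hg (z t))) as Hgt.
    destruct (Hgt eps Heps) as [d [Hd Hlim]].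
    (* The difference quotient of [z] will be exactly [g c]. As [z] moves at speed at most [M], a
       time step below [d / M] keeps [c] within [d] of [z t]. *)
    assert (HdM : 0 < d / M) by (apply Rdiv_lt_0_compat; lra).
    exists (mkposreal _ HdM); intros h Hh0 Hh; simpl in Hh.
    destruct (Hinc (z t) (z (t + h))) as [c [Hc He]].
    rewrite !HGz in He; replace (t + h - t) with h in He by ring.
    rewrite He; replace (g c * h / h) with (g c) by (field; exact Hh0).
    (* The limit in [continuity_pt] is over punctured neighbourhoods, so [c = z t] is treated
       apart. *)
    destruct (Req_dec c (z t)) as [->|Hne].
    { rewrite Rminus_diag, Rabs_R0; exact Heps. }
    apply Hlim; split; [split; [exact I|auto]|].
    apply Rle_lt_trans with (1 := Hc).
    rewrite He, Rabs_mult, (Rabs_pos_eq (g c)) by (specialize (Hgp c); lra).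
    apply Rle_lt_trans with (M * Rabs h).
    { apply Rmult_le_compat_r; [apply Rabs_pos|apply Hb]. }
    apply Rmult_lt_compat_l with (r := M) in Hh; [|exact HM].
    replace (M * (d / M)) with d in Hh by (field; lra); exact Hh.
Qed.

(** * Uniqueness of forward solutions *)

(* Gronwall: [(x - y)^2 * exp (- 2 * L * t)] is nonincreasing. *)
Lemma forward_solution_unique (v : R -> R) (L t0 : R) (x y : R -> R) :
  (forall p q, Rabs (v p - v q) <= L * Rabs (p - q)) ->
  forward_solution (V := R_NormedModule) v t0 x ->
  forward_solution (V := R_NormedModule) v t0 y ->
  x t0 = y t0 -> forall t, t0 < t -> x t = y t.
Proof.
  intros HL [Hx Hx0] [Hy Hy0] H0 t Ht.
  set (E := fun s => (x s - y s) ^ 2 * exp (- (2 * L * s))).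
  set (dE := fun s => 2 * exp (- (2 * L * s)) *
      ((x s - y s) * (v (x s) - v (y s)) - L * (x s - y s) ^ 2)).
  assert (HE : forall s, t0 < s -> is_derive E s (dE s)).
  { intros s Hs; specialize (Hx s Hs); specialize (Hy s Hs).
    unfold E, dE; auto_derive.
    - repeat split; [exists (v (x s))|exists (v (y s))]; assumption.
    - rewrite (is_derive_unique _ _ _ Hx : Derive (fun x0 => x x0) s = v (x s)).
      rewrite (is_derive_unique _ _ _ Hy : Derive (fun x0 => y x0) s = v (y s)).
      ring. }
  assert (HdE : forall s, dE s <= 0).
  { intros s; unfold dE.
    assert ((x s - y s) * (v (x s) - v (y s)) <= L * (x s - y s) ^ 2).
    { apply Rle_trans with (1 := Rle_abs _); rewrite Rabs_mult, <- (pow2_abs (x s - y s)).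
      specialize (HL (x s) (y s)); pose proof (Rabs_pos (x s - y s)); nra. }
    pose proof (exp_pos (- (2 * L * s))); nra. }
  assert (Hmono : forall s, t0 < s < t -> E t <= E s).
  { intros s Hs; destruct (MVT_gen E s t dE) as [c [_ Hc]].
    - intros u Hu; rewrite Rmin_left in Hu by lra; apply HE; lra.
    - intros u Hu; rewrite Rmin_left in Hu by lra.
      apply continuity_pt_filterlim, (ex_derive_continuous E).
      exists (dE u); apply HE; lra.
    - specialize (HdE c); nra. }
  (* At [t0] only right-continuity is available, so monotonicity is proved on the open half-line and
     the initial condition enters through this limit. *)
  assert (Hlim : filterlim E (at_right t0) (locally 0)).
  { replace 0 with ((x t0 - y t0) ^ 2 * exp (- (2 * L * t0))) by (rewrite H0; ring).
    assert (Hd : filterlim (fun s => x s - y s) (at_right t0) (locally (x t0 - y t0))).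
    { apply (filterlim_comp_2 (G := locally (x t0)) (H := locally (opp (y t0)))
        x (fun s => opp (y s)) plus Hx0).
      - apply filterlim_comp with (1 := Hy0), (filterlim_opp (y t0)).
      - apply (filterlim_plus (V := R_NormedModule) (x t0) (opp (y t0))). }
    apply (filterlim_comp_2 (G := locally ((x t0 - y t0) ^ 2))
      (H := locally (exp (- (2 * L * t0))))
      (fun s => (x s - y s) ^ 2) (fun s => exp (- (2 * L * s))) Rmult).
    - apply filterlim_comp with (f := fun s => x s - y s) (g := fun p => p ^ 2) (1 := Hd).
      apply (ex_derive_continuous (fun p => p ^ 2)); auto_derive; exact I.
    - apply (filterlim_filter_le_1 (F := locally t0)); [apply filter_le_within|].
      apply (ex_derive_continuous (fun s => exp (- (2 * L * s)))); auto_derive; exact I.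
    - apply (filterlim_mult (K := R_AbsRing)). }
  assert (HEt : E t <= 0).
  { apply (filterlim_le (F := at_right t0) (fun _ => E t) E (E t) 0).
    - assert (Hdt : 0 < t - t0) by lra.
      exists (mkposreal _ Hdt); intros s Hs Hlt; apply Hmono; split; [exact Hlt|].
      apply Rabs_def2 in Hs; unfold minus, plus, opp in Hs; simpl in Hs; lra.
    - apply filterlim_const.
    - exact Hlim. }
  unfold E in HEt; pose proof (exp_pos (- (2 * L * t))) as He.
  destruct (Req_dec (x t) (y t)) as [|Hne]; [assumption|].
  assert (Hsq : 0 < (x t - y t) ^ 2) by (apply pow2_gt_0; lra).
  pose proof (Rmult_lt_0_compat _ _ Hsq He); lra.
Qed.

(** * Lipschitz bound and decaying solutions of the condensed field *)

(** With [P = theta * p ^ 2 + 1] and [Q = theta * q ^ 2 + 1], one has [p ^ 2 / P - q ^ 2 / Q = (p +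
    q) * (p - q) / (P * Q)]. Both [|p|] and [|q|] are at most [K * P * Q], so the quotient
    [(p + q) / (P * Q)] is bounded by [2 * K]. *)
Lemma condensed_field_lipschitz (a H theta beta : R) :
  0 < a -> 0 < theta -> 0 < H -> 0 <= beta ->
  exists L, forall p q,
    Rabs (condensed_field a H theta beta p - condensed_field a H theta beta q)
      <= L * Rabs (p - q).
Proof.
  intros ha ht hH hb.
  (* Expanding, [K * (theta * p ^ 2 + 1)] dominates [p ^ 2 + 1], hence [|p|]. *)
  set (K := 1 + / theta).
  assert (Hit : 0 < / theta) by (apply Rinv_0_lt_compat; lra).
  assert (HK : forall p, Rabs p <= K * (theta * p ^ 2 + 1)).
  { intros p; unfold K.
    replace ((1 + / theta) * (theta * p ^ 2 + 1))
      with (theta * p ^ 2 + p ^ 2 + 1 + / theta) by (field; lra).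
    assert (0 <= theta * p ^ 2) by (apply Rmult_le_pos; [lra|apply pow2_ge_0]).
    pose proof (pow2_ge_0 (p - 1)); pose proof (pow2_ge_0 (p + 1)).
    apply Rabs_le; split; nra. }
  exists (a + beta * H * (2 * K)); intros p q; unfold condensed_field.
  assert (HP : 1 <= theta * p ^ 2 + 1) by nra.
  assert (HQ : 1 <= theta * q ^ 2 + 1) by nra.
  replace (_ - _) with ((- a + beta * H * ((p + q) /
    ((theta * p ^ 2 + 1) * (theta * q ^ 2 + 1)))) * (p - q)) by (field; lra).
  rewrite Rabs_mult; apply Rmult_le_compat_r; [apply Rabs_pos|].
  apply Rle_trans with (1 := Rabs_triang _ _).
  rewrite Rabs_Ropp, (Rabs_pos_eq a) by lra; apply Rplus_le_compat_l.
  assert (HbH : 0 <= beta * H) by nra.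
  rewrite Rabs_mult, (Rabs_pos_eq _ HbH); apply Rmult_le_compat_l; [exact HbH|].
  rewrite Rabs_div, (Rabs_pos_eq (_ * _)) by nra.
  apply Rle_div_l; [nra|].
  apply Rle_trans with (1 := Rabs_triang _ _).
  pose proof (HK p); pose proof (HK q).
  assert (HK0 : 0 < K) by (unfold K; lra).
  set (P := theta * p ^ 2 + 1) in *; set (Q := theta * q ^ 2 + 1) in *.
  assert (K * P <= K * (P * Q)) by (apply Rmult_le_compat_l; nra).
  assert (K * Q <= K * (P * Q)) by (apply Rmult_le_compat_l; nra).
  lra.
Qed.

(** While [|x| <= |x0|], the nonlinear term divided by [x] is at most [beta * H * |x0| <= a / 2] in
    absolute value, leaving half of the linear damping. The factor [x0] carries the sign, so no case
    split is needed. *)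
Lemma condensed_field_decaying_solution (a H theta beta t0 x0 : R) :
  0 < a -> 0 < theta -> 0 < H -> 0 <= beta ->
  beta * H * Rabs x0 <= a / 2 ->
  exists x : R -> R,
    forward_solution (V := R_NormedModule) (condensed_field a H theta beta) t0 x /\
    x t0 = x0 /\
    forall t, t0 < t -> Rabs (x t) <= Rabs x0 * exp (- (a / 2 * (t - t0))).
Proof.
  intros ha ht hH hb Hx0.
  set (e := fun z => x0 * exp (- Rmax z 0)).
  (* Truncating at [z = 0] makes [g] bounded below on the whole line; the
     solution stays nonnegative in forward time, where [Rmax z 0 = z]. *)
  set (g := fun z => a - beta * H * (e z / (theta * e z ^ 2 + 1))).
  assert (Hc : forall z, continuous g z).
  { intros z.
    apply (continuous_comp (fun z => Rmax z 0)
      (fun r => a - beta * H * (x0 * exp (- r) / (theta * (x0 * exp (- r)) ^ 2 + 1)))).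
    - apply continuous_ext with (fun z => (z + Rabs z) / 2).
      { intros s; unfold Rmax, Rabs; destruct Rle_dec, Rcase_abs; lra. }
      apply (continuous_scal_l (K := R_AbsRing) (V := R_NormedModule)
               (fun z => z + Rabs z) (/ 2)).
      apply (continuous_plus (V := R_NormedModule)); [apply continuous_id|].
      apply continuous_Rabs.
    - apply (ex_derive_continuous (V := R_NormedModule)); auto_derive.
      pose proof (pow2_ge_0 (x0 * exp (- Rmax z 0))); nra. }
  assert (Hb : forall z, a / 2 <= g z <= 2 * a).
  { intros z; unfold g.
    assert (He : Rabs (e z) <= Rabs x0).
    { unfold e; rewrite Rabs_mult, (Rabs_pos_eq (exp _)) by (left; apply exp_pos).
      rewrite <- (Rmult_1_r (Rabs x0)) at 2.
      apply Rmult_le_compat_l; [apply Rabs_pos|].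
      rewrite <- exp_0; apply exp_le; pose proof (Rmax_r z 0); lra. }
    assert (HD : 1 <= theta * e z ^ 2 + 1) by (pose proof (pow2_ge_0 (e z)); nra).
    assert (Hu : Rabs (beta * H * (e z / (theta * e z ^ 2 + 1))) <= a / 2).
    { assert (HbH : 0 <= beta * H) by nra.
      apply Rle_trans with (2 := Hx0).
      rewrite Rabs_mult, (Rabs_pos_eq _ HbH); apply Rmult_le_compat_l; [exact HbH|].
      rewrite Rabs_div, (Rabs_pos_eq (_ + 1)) by lra.
      apply Rle_div_l; [lra|]; pose proof (Rabs_pos x0); nra. }
    apply Rabs_le_between in Hu; lra. }
  destruct (autonomous_ode_solution g (a / 2) (2 * a)) as [z [Hz0 Hz]]; [lra|exact Hc|exact Hb|].
  (* Used twice: it shows that the truncation is inactive in forward time, and it gives the decay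
     rate. *)
  assert (Hzt : forall t, 0 <= t -> a / 2 * t <= z t).
  { intros t Htp.
    destruct (is_derive_increment z (fun t => g (z t)) 0 t Hz) as [c [_ Hc']].
    destruct (Hb (z c)); nra. }
  set (x := fun t => x0 * exp (- z (t - t0))).
  assert (Hx : forall t, is_derive x t (- g (z (t - t0)) * x t)).
  { intros t; unfold x; auto_derive.
    - exists (g (z (t - t0))); apply Hz.
    - change (t + - t0) with (t - t0).
      rewrite (is_derive_unique _ _ _ (Hz (t - t0)) :
        Derive (fun s => z s) (t - t0) = g (z (t - t0))); ring. }
  exists x; split; [split|split].
  - intros t Htt; specialize (Hx t).
    replace (condensed_field a H theta beta (x t)) with (- g (z (t - t0)) * x t);
      [exact Hx|].
    assert (Hpos : 0 <= z (t - t0)).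
    { apply Rle_trans with (2 := Hzt (t - t0) ltac:(lra)); nra. }
    assert (Hex : e (z (t - t0)) = x t) by (unfold e, x; rewrite Rmax_left; auto).
    unfold g; rewrite Hex; unfold condensed_field.
    pose proof (pow2_ge_0 (x t)); field; nra.
  - apply (filterlim_filter_le_1 (F := locally t0)); [apply filter_le_within|].
    apply (ex_derive_continuous x); eexists; apply Hx.
  - unfold x; rewrite Rminus_diag, Hz0, Ropp_0, exp_0; ring.
  - intros t Htt; unfold x.
    rewrite Rabs_mult, (Rabs_pos_eq (exp _)) by (left; apply exp_pos).
    apply Rmult_le_compat_l; [apply Rabs_pos|].
    apply exp_le; pose proof (Hzt (t - t0) ltac:(lra)); lra.
Qed.

(** * Convergence to the equilibrium *)

Lemma filterlim_0_of_exp_decay (x : R -> R) (k C t0 : R) :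
  0 < k -> 0 <= C ->
  (forall t, t0 < t -> Rabs (x t) <= C * exp (- (k * (t - t0)))) ->
  filterlim x (Rbar_locally p_infty) (locally 0).
Proof.
  intros Hk HC Hx P [eps HP].
  pose proof (cond_pos eps) as Heps.
  assert (Hke : 0 < k * eps) by nra.
  (* Past this time [s = k * (t - t0)] satisfies [C < s * eps], and [s < exp s] then gives
     [C * exp (- s) < eps]. *)
  exists (t0 + C / (k * eps)); intros t Ht; apply HP.
  assert (Hq : 0 <= C / (k * eps)) by (apply Rdiv_le_0_compat; lra).
  specialize (Hx t ltac:(lra)).
  change (Rabs (x t - 0) < eps); rewrite Rminus_0_r.
  apply Rle_lt_trans with (1 := Hx).
  assert (Hs : C < (t - t0) * (k * eps)) by (apply Rlt_div_l; lra).
  set (s := k * (t - t0)) in *.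
  assert (Hsp : 0 < s) by (unfold s; nra).
  pose proof (exp_ineq1_le s) as Hexp; pose proof (exp_pos s).
  rewrite exp_Ropp; apply Rlt_div_l; [lra|].
  apply Rlt_le_trans with (s * eps); [unfold s; lra|nra].
Qed.

Theorem theorem3p3 (a theta H beta : R)
    (ha : 0 < a) (htheta : 0 < theta) (hH : 0 < H) (hbeta : 0 <= beta) :
  exists xe : R,
    asymptotically_stable_at (V := R_NormedModule) (condensed_field a H theta beta) xe.
Proof.
  exists 0.
  set (v := condensed_field a H theta beta).
  assert (Hv : (fun y : R => v (0 + y)) = v).
  { apply functional_extensionality; intros y; rewrite Rplus_0_l; reflexivity. }
  change (asymptotically_stable_origin (V := R_NormedModule) (fun y : R => v (0 + y))).
  rewrite Hv.
  destruct (condensed_field_lipschitz a H theta beta) as [L HL]; try assumption.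
  split; [|split].
  - intros x; exists L, (mkposreal 1 Rlt_0_1); intros y z _ _; exact (HL y z).
  - change (condensed_field a H theta beta 0 = 0); unfold condensed_field.
    field; lra.
  - assert (HbH : 0 <= beta * H) by nra.
    (* Chosen so that [beta * H * |x0| <= a / 2]; the [+ 1] keeps the denominator positive when
       [beta = 0]. *)
    exists (a / (2 * (beta * H + 1))); split; [apply Rdiv_lt_0_compat; lra|].
    intros t0 x0 Hx0; change (Rabs x0 < a / (2 * (beta * H + 1))) in Hx0.
    apply Rlt_div_r in Hx0; [|lra].
    destruct (condensed_field_decaying_solution a H theta beta t0 x0)
      as [z [Hz [Hz0 Hdec]]]; try assumption.
    { pose proof (Rabs_pos x0); lra. }
    split; [exists z; split; assumption|].
    intros x Hx Hxt0.
    apply (filterlim_0_of_exp_decay x (a / 2) (Rabs x0) t0);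
      [lra|apply Rabs_pos|].
    intros t Ht.
    rewrite (forward_solution_unique v L t0 x z HL Hx Hz ltac:(congruence) t Ht).
    apply Hdec, Ht.
Qed.
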